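(* Let $F \colon Y \rightharpoonup Y$ be a partial map on a set $Y$ with a cost function $c \colon Y^2 \to [0,\infty]$. The following statements hold for any subset $A \subseteq Y$ with $A \cap \operatorname{Im} F \neq \emptyset$: (1) The families $(A_{F,\varepsilon})_{\varepsilon \in (-\infty,-0] \sqcup [0,\infty]}$ and $(A_{F,\varepsilon_{\Sigma}})_{\varepsilon \in (-\infty,-0] \sqcup [0,\infty]}$ are filtrations. (2) If the cost function $c$ is non-degenerate and $A \subseteq Y - \operatorname{dom}F$, then the families $(A_{F,\varepsilon})_{\varepsilon \in \mathbb{R} \sqcup \{\infty\}}$ and $(A_{F,\varepsilon_{\Sigma}})_{\varepsilon \in \mathbb{R} \sqcup \{\infty\}}$ are filtrations. (3) If $c^{-1}(\infty) = \emptyset$, then $(A_{F,\varepsilon})_{\varepsilon \in (-\infty,-0] \sqcup [0,\infty)}$ and $(A_{F,\varepsilon_{\Sigma}})_{\varepsilon \in (-\infty,-0] \sqcup [0,\infty)}$ are filtrations. (4) If the cost function $c$ is non-degenerate, $A \subseteq Y - \operatorname{dom}F$ and $c^{-1}(\infty) = \emptyset$, then $(A_{F,\varepsilon})_{\varepsilon \in \mathbb{R}}$ and $(A_{F,\varepsilon_{\Sigma}})_{\varepsilon \in \mathbb{R}}$ are filtrations. (Here ''filtration'' means filtration on $Y$.)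
   Context: Filtration: a family $(F_i)_{i\in I}$ of subsets of a set $Y$ indexed by a totally ordered set $I$ is a filtration (on $Y$) if $Y=\bigcup_{i\in I}F_i$ and $F_{i_1}\subseteq F_{i_2}$ whenever $i_1\le i_2$. Index sets: in $(-\infty,-0]\sqcup[0,\infty]$ the symbols $-0$ and $0$ are two distinct indices; the order is the usual one on non-zero reals, with every negative real $<-0<0<$ every positive real, and $\infty$ is the maximum. $(-\infty,-0]\sqcup[0,\infty)$ is the same without $\infty$. In the index sets $\mathbb{R}$ and $\mathbb{R}\sqcup\{\infty\}$ there is a single zero. Partial maps and costs: a partial map $F\colon Y\rightharpoonup Y$ is a map from a subset $\operatorname{dom}F\subseteq Y$ to $Y$; $\operatorname{Im}F=F(\operatorname{dom}F)$. A cost function on $Y$ is a function $c\colon Y\times Y\to[0,\infty]$ with $c(y,y)=0$ for all $y$; it is non-degenerate if $c^{-1}(0)=\{(y,y)\mid y\in Y\}$. Reachable sets: let $\varepsilon\in[0,\infty]$ and $y\in Y$. The set $[y]_F^{\varepsilon}$ consists of $y$ itself (path of length $0$) together with all points of the form $F(y_{n-1})$, where $n\ge 1$ and $(y_0,\dots,y_{n-1})\in(\operatorname{dom}F)^n$ satisfies $c(y,y_0)\le\varepsilon$ and $c(F(y_i),y_{i+1})\le\varepsilon$ for all $0\le i\le n-2$. The set $[y]_F^{\varepsilon_\Sigma}$ consists of $y$ itself together with all points of the form $F(y_{n-1})$, where $n\ge1$, $(y_0,\dots,y_{n-1})\in(\operatorname{dom}F)^n$, and there is $(\varepsilon_0,\dots,\varepsilon_{n-1})\in[0,\infty]^n$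 with $\sum_{i=0}^{n-1}\varepsilon_i\le\varepsilon$, $c(y,y_0)\le\varepsilon_0$ and $c(F(y_i),y_{i+1})\le\varepsilon_{i+1}$ for all $0\le i\le n-2$. Attracting basins of $A\subseteq Y$: for $\varepsilon\in[0,\infty]$, $A_{F,\varepsilon}:=\{y\in Y\mid [y]_F^{\varepsilon}\cap A\ne\emptyset\}$. Next, $A_{F,-0}:=\{y\in Y\mid \emptyset\ne[y]_F^{0}\setminus\operatorname{dom}F\subseteq A\}$, and for $\varepsilon\in(0,\infty]$, $A_{F,-\varepsilon}:=\{y\in A_{F,-0}\mid\emptyset\ne[y]_F^{\varepsilon}\setminus\operatorname{dom}F\subseteq A\}$. The sets $A_{F,\varepsilon_\Sigma}$, $A_{F,-0_\Sigma}$, $A_{F,-\varepsilon_\Sigma}$ are defined in the same way with $[y]_F^{\varepsilon_\Sigma}$, $[y]_F^{0_\Sigma}$ in place of $[y]_F^{\varepsilon}$, $[y]_F^{0}$. In each family the member of index $0$ is $A_{F,0}$ (resp. $A_{F,0_\Sigma}$), the member of index $-0$ (when present) is $A_{F,-0}$ (resp. $A_{F,-0_\Sigma}$), and the member of negative index $-\varepsilon$ ($\varepsilon>0$) is $A_{F,-\varepsilon}$ (resp. $A_{F,-\varepsilon_\Sigma}$). *)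

(* Defs.v *)
From HB Require Import structures.
From mathcomp Require Import all_boot all_order all_algebra.
From mathcomp Require Import all_classical all_reals.

Set Implicit Arguments.
Unset Strict Implicit.
Unset Printing Implicit Defensive.

Import Order.TTheory GRing.Theory Num.Theory.

Local Open Scope classical_set_scope.
Local Open Scope ring_scope.
Local Open Scope ereal_scope.

(* The totally ordered index set is a subset [I] of an [orderType]; the values
   of [B] outside [I] are irrelevant. *)
Definition filtration d (T : orderType d) (Y : Type) (I : set T)
    (B : T -> set Y) : Prop :=
  \bigcup_(i in I) B i = [set: Y] /\
  (forall i1 i2, I i1 -> I i2 -> (i1 <= i2)%O -> B i1 `<=` B i2).

Record partial_map (Y : Type) := PartialMap {
  dom : set Y;
  pmap_fun :> dom -> Y
}.

Section Reachability.
Context {R : realType} {Y : Type}.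
Implicit Types (c : Y -> Y -> \bar R) (F : partial_map Y) (A : set Y).

Definition cost_function c : Prop :=
  (forall y z, 0 <= c y z) /\ (forall y, c y y = 0).

Definition nondegenerate_cost c : Prop := forall y z, c y z = 0 <-> y = z.

(* A path of length n.+1 is p 0, ..., p n, so its end point is F (p n). *)
Definition reach c F (eps : \bar R) (y : Y) : set Y :=
  [set z | z = y \/
    exists (n : nat) (p : 'I_n.+1 -> dom F),
      [/\ c y (val (p ord0)) <= eps,
          forall i j : 'I_n.+1, j = i.+1 :> nat ->
            c (F (p i)) (val (p j)) <= eps
        & z = F (p ord_max)]].

Definition reach_sum c F (eps : \bar R) (y : Y) : set Y :=
  [set z | z = y \/
    exists (n : nat) (p : 'I_n.+1 -> dom F) (e : 'I_n.+1 -> \bar R),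
      [/\ forall i, 0 <= e i,
          \sum_(i < n.+1) e i <= eps,
          c y (val (p ord0)) <= e ord0,
          forall i j : 'I_n.+1, j = i.+1 :> nat ->
            c (F (p i)) (val (p j)) <= e j
        & z = F (p ord_max)]].

(* Basins for an arbitrary reachability operator [r], to be instantiated with
   [reach c F] or [reach_sum c F]: the members of index eps >= 0, of index -0,
   and of index -eps for eps > 0. *)
Section Basins.
Variables (F : partial_map Y) (r : \bar R -> Y -> set Y) (A : set Y).

Definition basin (eps : \bar R) : set Y := [set y | r eps y `&` A !=set0].

Definition basin_neg0 : set Y :=
  [set y | r 0 y `\` dom F !=set0 /\ r 0 y `\` dom F `<=` A].

Definition basin_neg (eps : \bar R) : set Y :=
  [set y | [/\ basin_neg0 y, r eps y `\` dom F !=set0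
             & r eps y `\` dom F `<=` A]].

Definition basin_family (x : \bar R) : set Y :=
  if 0 <= x then basin x else basin_neg (- x).

(* Indices with two zeros: (false, x) with x <= 0 is the point x of (-oo, -0],
   so that -0 is (false, 0), and (true, x) with 0 <= x is the point x of
   [0, +oo]. *)
Definition basin_split_family (i : bool *l \bar R) : set Y :=
  let: (b, x) := i in
  if b then basin x else if x == 0 then basin_neg0 else basin_neg (- x).

End Basins.
End Reachability.

Section IndexSets.
Variable R : realType.

Definition real_idx : set (\bar R) := range EFin.

Definition real_idx_oo : set (\bar R) := real_idx `|` [set +oo].

(* The lexicographic order puts every (false, x) below every (true, x'). *)
Definition split_idx : set (bool *l \bar R) :=
  [set i | exists2 x : R, (x <= 0)%R & i = (false, x%:E)] `|`
  [set i | exists2 x : R, (0 <= x)%R & i = (true, x%:E)].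

Definition split_idx_oo : set (bool *l \bar R) :=
  split_idx `|` [set (true, +oo)].

End IndexSets.

Arguments real_idx R : clear implicits.
Arguments real_idx_oo R : clear implicits.
Arguments split_idx R : clear implicits.
Arguments split_idx_oo R : clear implicits.

(* Main.v *)
(** In all the families, a point [y] of a basin of negative index reaches a
    point outside [dom F] at cost [0], hence at every cost, and all such points
    lie in [A]; monotonicity of reachability in the cost then orders the basins.
    They cover [Y] because any [y] reaches a fixed [F x] in [A] by a path of
    length one, of cost [c y x]. Merging the two zeros just discards the basin
    of index [-0], so it preserves both properties. *)
Require Import Defs.
From mathcomp Require Import all_boot all_order all_algebra.
From mathcomp Require Import all_classical all_reals.

Local Open Scope classical_set_scope.
Local Open Scope ereal_scope.

Import Order.TTheory GRing.Theory Num.Theory.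

Section Monotonicity.
Context {R : realType} {Y : Type}.
Implicit Types (c : Y -> Y -> \bar R) (F : partial_map Y) (A : set Y).
Implicit Types (e : \bar R) (y : Y).

Lemma reach_mono c F e1 e2 y : e1 <= e2 -> reach c F e1 y `<=` reach c F e2 y.
Proof.
move=> le12 z [->|[n [p [h0 hS ->]]]]; [by left|right; exists n, p].
by split=> [|i j ij|//]; [exact: le_trans le12|exact: le_trans (hS _ _ ij) le12].
Qed.

Lemma reach_sum_mono c F e1 e2 y :
  e1 <= e2 -> reach_sum c F e1 y `<=` reach_sum c F e2 y.
Proof.
move=> le12 z [->|[n [p [e [e0 se h0 hS ->]]]]]; [by left|right; exists n, p, e].
by split=> //; exact: le_trans le12.
Qed.

Lemma reach_step c F y (x : dom F) : reach c F (c y (val x)) y (F x).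
Proof.
right; exists 0%N, (fun=> x); split=> // i j.
(* Both indices in ['I_1] are [0], so the premise [j = i.+1] is absurd and the chaining condition is
   vacuous. *)
by rewrite (ord1 i) (ord1 j).
Qed.

Lemma reach_sum_step c F y (x : dom F) :
  cost_function c -> reach_sum c F (c y (val x)) y (F x).
Proof.
move=> [c0 _]; right; exists 0%N, (fun=> x), (fun=> c y (val x)).
split=> // [|i j]; first by rewrite big_ord1.
by rewrite (ord1 i) (ord1 j).
Qed.

End Monotonicity.

Section Basins.
Context {R : realType} {Y : Type} (F : partial_map Y).
Context (r : \bar R -> Y -> set Y) (A : set Y).
Hypothesis r_mono : forall e1 e2 y, e1 <= e2 -> r e1 y `<=` r e2 y.

Lemma basin_mono e1 e2 : e1 <= e2 -> basin r A e1 `<=` basin r A e2.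
Proof. by move=> le12 y [z [rz Az]]; exists z; split=> //; exact: r_mono rz. Qed.

(** A smaller budget leaves fewer points to be contained in [A]. Nonemptiness does not pass from
    [e2] down to [e1]; it comes from the part at budget [0], which is why [0 <= e1] is required. *)
Lemma basin_neg_anti e1 e2 :
  0 <= e1 -> e1 <= e2 -> basin_neg F r A e2 `<=` basin_neg F r A e1.
Proof.
move=> e10 le12 y [y0 _ sA]; split=> //.
  by case: y0 => -[z [rz Fz]] _; exists z; split=> //; exact: r_mono rz.
by move=> z [rz Fz]; apply: sA; split=> //; exact: r_mono rz.
Qed.

Lemma basin_neg_neg0 e : basin_neg F r A e `<=` basin_neg0 F r A.
Proof. by move=> y []. Qed.

(** The point outside [dom F] reached at budget [0] lies in [A] and remains reachable at budget [e].
    This links the two halves of each family. *)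
Lemma basin_neg0_basin e : 0 <= e -> basin_neg0 F r A `<=` basin r A e.
Proof.
move=> e0 y [[z rFz] sA]; exists z; split; last exact: sA.
by case: rFz => rz _; exact: r_mono rz.
Qed.

Lemma basin_family_mono e1 e2 :
  e1 <= e2 -> basin_family F r A e1 `<=` basin_family F r A e2.
Proof.
move=> le12; rewrite /basin_family; case: (leP 0 e2) => e20; last first.
  rewrite leNgt (le_lt_trans le12 e20) /=.
  by apply: basin_neg_anti; rewrite ?leeN2// oppe_ge0 ltW.
case: leP => _; first exact: basin_mono.
(* Here [e1 < 0 <= e2]: the inclusion passes through the basin of index [-0]. *)
exact: subset_trans (basin_neg_neg0 _) (basin_neg0_basin _ e20).
Qed.

Lemma split_idx_ooP (i : bool *l \bar R) :
  split_idx_oo R i -> if i.1 then 0 <= i.2 else i.2 <= 0.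
Proof. by case=> [[[x x0 ->]|[x x0 ->]]|->] /=; rewrite ?lee_fin ?leey. Qed.

Lemma basin_split_family_mono i1 i2 :
  split_idx_oo R i1 -> split_idx_oo R i2 -> (i1 <= i2)%O ->
  basin_split_family F r A i1 `<=` basin_split_family F r A i2.
Proof.
move=> /split_idx_ooP + /split_idx_ooP.
case: i1 i2 => [[] x1] [[] x2] /= x10 x20;
  rewrite Order.ProdLexiOrder.lexi_pair //= => le12.
(* The lexicographic order has already excluded [i1] in the upper half with [i2] in the lower
   half. *)
- exact: basin_mono.
- case: eqP => _; first exact: basin_neg0_basin.
  exact: subset_trans (basin_neg_neg0 _) (basin_neg0_basin _ x20).
- case: (eqVneq x2 0) => [_|x2n0].
    by case: eqP => _ //; exact: basin_neg_neg0.
  case: eqP => [x1E|_]; last by apply: basin_neg_anti; rewrite ?leeN2 ?oppe_ge0.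
  (* Index [-0] is the top of the lower half: [0 = x1 <= x2 <= 0] would force [x2 = 0]. *)
  by move: x2n0; rewrite eq_le x20 -x1E le12.
Qed.

Context (c : Y -> Y -> \bar R) (x : dom F).
Hypothesis c_ge0 : forall y z, 0 <= c y z.
Hypothesis r_step : forall y, r (c y (val x)) y (F x).
Hypothesis AFx : A (F x).

(** Every covering reduces to this: for each [y], the index set needs only some index [e] of at
    least [c y (val x)]. *)
Lemma basin_step e y : c y (val x) <= e -> basin r A e y.
Proof. by move=> ce; exists (F x); split=> //; exact: r_mono (r_step y). Qed.

Lemma filtration_basin_split_oo :
  filtration (split_idx_oo R) (basin_split_family F r A).
Proof.
split; last exact: basin_split_family_mono.
apply/seteqP; split=> // y _; exists (true, +oo); first by right.
by apply: basin_step; rewrite leey.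
Qed.

Lemma filtration_basin_oo : filtration (real_idx_oo R) (basin_family F r A).
Proof.
split; last by move=> ? ? _ _; exact: basin_family_mono.
apply/seteqP; split=> // y _; exists +oo; first by right.
by rewrite /basin_family leey; apply: basin_step; rewrite leey.
Qed.

Hypothesis c_fin : forall y z, c y z <> +oo.

Lemma cost_fin_num y z : c y z \is a fin_num.
Proof. by rewrite ge0_fin_numE// ltey; apply/eqP. Qed.

Lemma filtration_basin_split :
  filtration (split_idx R) (basin_split_family F r A).
Proof.
split; last by move=> ? ? I1 I2; apply: basin_split_family_mono; left.
(* Without [+oo] no single index need serve all [y]; the cost of the step from [y] to [x] is chosen,
   a real index because it is finite. *)
apply/seteqP; split=> // y _; exists (true, c y (val x)); last exact: basin_step.
by right; exists (fine (c y (val x))); rewrite ?fine_ge0 ?fineK ?cost_fin_num.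
Qed.

Lemma filtration_basin : filtration (real_idx R) (basin_family F r A).
Proof.
split; last by move=> ? ? _ _; exact: basin_family_mono.
apply/seteqP; split=> // y _; exists (c y (val x)).
  by exists (fine (c y (val x))); rewrite ?fineK ?cost_fin_num.
by rewrite /basin_family c_ge0; exact: basin_step.
Qed.

End Basins.

Theorem theorem2p9 (R : realType) (Y : Type) (F : partial_map Y)
    (c : Y -> Y -> \bar R) (hc : cost_function c)
    (A : set Y) (hA : A `&` range F !=set0) :
  [/\ filtration (split_idx_oo R) (basin_split_family F (reach c F) A) /\
      filtration (split_idx_oo R) (basin_split_family F (reach_sum c F) A),
      nondegenerate_cost c -> A `<=` ~` dom F ->
      filtration (real_idx_oo R) (basin_family F (reach c F) A) /\
      filtration (real_idx_oo R) (basin_family F (reach_sum c F) A),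
      (forall y z, c y z <> +oo) ->
      filtration (split_idx R) (basin_split_family F (reach c F) A) /\
      filtration (split_idx R) (basin_split_family F (reach_sum c F) A)
    & nondegenerate_cost c -> A `<=` ~` dom F -> (forall y z, c y z <> +oo) ->
      filtration (real_idx R) (basin_family F (reach c F) A) /\
      filtration (real_idx R) (basin_family F (reach_sum c F) A)].
Proof.
case: hA => z [Az [x _ Fx]]; have AFx : A (F x) by rewrite Fx.
have c_ge0 := hc.1.
(* Both reachability operators enter the basin arguments only through monotonicity in the budget and
   the one-step path to [F x]. *)
have rm := @reach_mono R Y c F; have sm := @reach_sum_mono R Y c F.
have rs y := reach_step c F y x; have ss y := reach_sum_step c F y x hc.
split=> [|_ _|cfin|_ _ cfin]; split.
- exact: (filtration_basin_split_oo F _ A rm c x rs AFx).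
- exact: (filtration_basin_split_oo F _ A sm c x ss AFx).
- exact: (filtration_basin_oo F _ A rm c x rs AFx).
- exact: (filtration_basin_oo F _ A sm c x ss AFx).
- exact: (filtration_basin_split F _ A rm c x c_ge0 rs AFx cfin).
- exact: (filtration_basin_split F _ A sm c x c_ge0 ss AFx cfin).
- exact: (filtration_basin F _ A rm c x c_ge0 rs AFx cfin).
- exact: (filtration_basin F _ A sm c x c_ge0 ss AFx cfin).
Qed.
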